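(* Let $\Omega$ be a locally compact Hausdorff space and let $G$ be a compact subgroup of $\mathrm{Aut}^+_s(C_0(\Omega))$. Then the map $p|_G \colon G \to \mathrm{Homeo}(\Omega)$ is continuous.
   Context: $C_0(\Omega)$ is the Banach lattice of real-valued continuous functions on $\Omega$ vanishing at infinity, with the supremum norm. $\mathrm{Aut}^+_s(C_0(\Omega))$ is the group of lattice automorphisms of $C_0(\Omega)$ with the strong operator topology. $\mathrm{Homeo}(\Omega)$ is the group of homeomorphisms of $\Omega$, identified with a subgroup of $\mathrm{Aut}^+_s(C_0(\Omega))$ via $\phi x := x\circ\phi^{-1}$ for $x\in C_0(\Omega)$, and equipped with the strong operator topology. $C_b(\Omega)^{++}$ is the set of bounded continuous functions $m$ on $\Omega$ for which there is a $\delta>0$ with $m(\omega)\ge\delta$ for all $\omega\in\Omega$, identified with multiplication operators on $C_0(\Omega)$. Every lattice automorphism $T$ of $C_0(\Omega)$ can be written uniquely as $T=m\phi$ with $m\in C_b(\Omega)^{++}$ and $\phi\in\mathrm{Homeo}(\Omega)$, and $p$ is the group homomorphism $p(m\phi):=\phi$. *)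

(* Defs.v *)
From HB Require Import structures.
From mathcomp Require Import all_boot all_order all_algebra.
From mathcomp Require Import all_classical all_reals all_analysis.

Set Implicit Arguments.
Unset Strict Implicit.
Unset Printing Implicit Defensive.

Import Order.TTheory GRing.Theory Num.Theory.
Import numFieldNormedType.Exports.

Local Open Scope classical_set_scope.
Local Open Scope ring_scope.

Section Vanishing.
Context {R : realType} {Omega : topologicalType}.
Implicit Types f g h : Omega -> R.

Definition vanishing_at_infinity f : Prop :=
  forall e : R, 0 < e -> compact [set w | e <= `|f w|].

Lemma closed_ge_norm f (e : R) : continuous f -> closed [set w | e <= `|f w|].
Proof.
move=> cf; apply: (@closed_comp _ _ (fun w => `|f w|) [set x | e <= x]).
  by move=> w _; apply: (@cvg_norm _ _ _ _ _ f (f w)); exact: cf.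
exact: closed_ge.
Qed.

Lemma vanishing_of_subset h : continuous h ->
  (forall e : R, 0 < e ->
    exists2 K, compact K & [set w | e <= `|h w|] `<=` K) ->
  vanishing_at_infinity h.
Proof.
move=> ch H e /H[K cK sK]; apply: subclosed_compact cK sK.
exact: closed_ge_norm.
Qed.

Lemma lin_continuous (a : R) f g : continuous f -> continuous g ->
  continuous (a *: f + g).
Proof.
move=> cf cg w; apply: (@cvgD _ _ _ _ _ (a *: f) g); last exact: cg.
by apply: (@cvgM _ _ _ _ (fun=> a) f); [exact: cvg_cst|exact: cf].
Qed.

Lemma vanishing_lin (a : R) f g : continuous f -> continuous g ->
  vanishing_at_infinity f -> vanishing_at_infinity g ->
  vanishing_at_infinity (a *: f + g).
Proof.
move=> cf cg vf vg; apply: vanishing_of_subset; first exact: lin_continuous.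
move=> e e0; have a1 : 0 < `|a| + 1 by rewrite ltr_wpDl.
have e2 : 0 < e / 2 by rewrite divr_gt0.
exists ([set w | e / 2 / (`|a| + 1) <= `|f w|] `|` [set w | e / 2 <= `|g w|]).
  by apply: compactU; [apply: vf; rewrite divr_gt0|exact: vg].
move=> w /= ew; have [gw|gw] := lerP (e / 2) `|g w|; first by right.
left; rewrite ler_pdivrMr//.
have : e <= `|a| * `|f w| + `|g w|.
  by rewrite (le_trans ew)// -normrM; exact: ler_normD.
rewrite {1}(splitr e) => H; have {H} : e / 2 <= `|a| * `|f w|.
  by rewrite -(lerD2r (e / 2)) (le_trans H)// lerD2l ltW.
by move=> /le_trans; apply; rewrite mulrC ler_wpM2l// lerDl.
Qed.

Lemma vanishing_dominated f g h : continuous h ->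
  vanishing_at_infinity f -> vanishing_at_infinity g ->
  (forall w, `|h w| <= Num.max `|f w| `|g w|) -> vanishing_at_infinity h.
Proof.
move=> ch vf vg hfg; apply: vanishing_of_subset => // e e0.
exists ([set w | e <= `|f w|] `|` [set w | e <= `|g w|]).
  by apply: compactU; [exact: vf|exact: vg].
by move=> w /= /le_trans/(_ (hfg w)); rewrite le_max => /orP.
Qed.

Definition is_c0 : {pred Omega -> R} :=
  [pred f | `[< continuous f /\ vanishing_at_infinity f >]].

Lemma is_c0P f : f \in is_c0 <-> continuous f /\ vanishing_at_infinity f.
Proof. by split; [move/asboolP|move=> ?; apply/asboolP]. Qed.

Lemma is_c0_submod : submod_closed is_c0.
Proof.
split.
  apply/is_c0P; split; first exact: cst_continuous.
  move=> e e0; rewrite (_ : mkset _ = set0); first exact: compact0.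
  by rewrite -subset0 => w /=; rewrite normr0 leNgt e0.
move=> a f g /is_c0P[cf vf] /is_c0P[cg vg].
by apply/is_c0P; split; [exact: lin_continuous|exact: vanishing_lin].
Qed.

HB.instance Definition _ :=
  GRing.isSubmodClosed.Build R (Omega -> R) is_c0 is_c0_submod.

Lemma is_c0_bounded f : f \in is_c0 -> exists M, forall w, `|f w| <= M.
Proof.
move=> /is_c0P[cf /(_ 1 ltr01) K].
have : compact (f @` [set w | 1 <= `|f w|]).
  by apply: continuous_compact => //; exact: continuous_subspaceT.
move=> /compact_bounded[M [_ /(_ (`|M| + 1))]].
have -> : M < `|M| + 1 by rewrite (le_lt_trans (ler_norm M))// ltrDl.
move=> /(_ isT) H; exists (`|M| + 1) => w.
have [fw|/ltW fw] := lerP 1 `|f w|; first by apply: H; exists w.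
by rewrite (le_trans fw)// lerDr.
Qed.

Lemma is_c0_max f g : f \in is_c0 -> g \in is_c0 -> f \max g \in is_c0.
Proof.
move=> /is_c0P[cf vf] /is_c0P[cg vg]; apply/is_c0P.
have cfg : continuous (f \max g).
  by move=> w; apply: continuous_max; [exact: cf|exact: cg].
split=> //; apply: (vanishing_dominated cfg vf vg) => w.
by rewrite /=; case: (leP (f w) (g w)) => _; rewrite le_max lexx ?orbT.
Qed.

Lemma is_c0_min f g : f \in is_c0 -> g \in is_c0 -> f \min g \in is_c0.
Proof.
move=> /is_c0P[cf vf] /is_c0P[cg vg]; apply/is_c0P.
have cfg : continuous (f \min g).
  by move=> w; apply: continuous_min; [exact: cf|exact: cg].
split=> //; apply: (vanishing_dominated cfg vf vg) => w.
by rewrite /=; case: (leP (f w) (g w)) => _; rewrite le_max lexx ?orbT.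
Qed.

End Vanishing.

Arguments is_c0 : clear implicits.

Section C0.
Variables (R : realType) (Omega : topologicalType).

Record C0 : Type := MkC0 {
  C0_fun :> Omega -> R;
  C0_funP : C0_fun \in is_c0 R Omega }.

HB.instance Definition _ := [isSub for C0_fun].
HB.instance Definition _ := [Choice of C0 by <:].
HB.instance Definition _ := [SubChoice_isSubLmodule of C0 by <:].

Implicit Types f g : C0.

Lemma C0_continuous f : continuous f.
Proof. by have /is_c0P[] := C0_funP f. Qed.

Lemma C0_vanishing f : vanishing_at_infinity f.
Proof. by have /is_c0P[] := C0_funP f. Qed.

Lemma C0P f g : (forall w, f w = g w) -> f = g.
Proof. by move=> fg; apply/val_inj/funext. Qed.

(* Sup norm; [sup set0 = 0], which is the right value when [Omega] is empty. *)
Definition C0_norm f : R := sup [set `|f w| | w in [set: Omega]].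

Lemma le_C0_norm f w : `|f w| <= C0_norm f.
Proof.
have [M fM] := is_c0_bounded (C0_funP f).
by apply: ub_le_sup; [exists M => _ [v _ <-]; exact: fM|exists w].
Qed.

Lemma C0_norm_le f (M : R) :
  0 <= M -> (forall w, `|f w| <= M) -> C0_norm f <= M.
Proof.
move=> M0 fM; rewrite /C0_norm; set A := [set _ | _ in _].
have [->|A0] := eqVneq A set0; first by rewrite sup0.
by apply: ge_sup; [exact/set0P|move=> _ [w _ <-]; exact: fM].
Qed.

Lemma C0_norm_ge0 f : 0 <= C0_norm f.
Proof.
rewrite /C0_norm; set A := [set _ | _ in _].
have [->|/set0P[_ [w _ _]]] := eqVneq A set0; first by rewrite sup0.
by rewrite (le_trans _ (le_C0_norm f w)).
Qed.

Lemma C0_ler_normD f g : C0_norm (f + g) <= C0_norm f + C0_norm g.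
Proof.
apply: C0_norm_le; first by rewrite addr_ge0 ?C0_norm_ge0.
by move=> w; rewrite (le_trans (ler_normD _ _))// lerD ?le_C0_norm.
Qed.

Lemma C0_normrZ (l : R) f : C0_norm (l *: f) = `|l| * C0_norm f.
Proof.
have le_Z k g : C0_norm (k *: g) <= `|k| * C0_norm g.
  apply: C0_norm_le; first by rewrite mulr_ge0 ?C0_norm_ge0.
  move=> w; have -> : (k *: g) w = k * g w by [].
  by rewrite normrM ler_wpM2l ?le_C0_norm.
have [->|l0] := eqVneq l 0.
  by apply/eqP; rewrite eq_le le_Z normr0 mul0r C0_norm_ge0.
apply/eqP; rewrite eq_le le_Z/= mulrC -ler_pdivlMr ?normr_gt0// mulrC.
by rewrite -normfV (le_trans _ (le_Z _ _))// scalerA mulVf// scale1r.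
Qed.

Lemma C0_normr0_eq0 f : C0_norm f = 0 -> f = 0.
Proof.
move=> f0; apply: C0P => w; apply/eqP; rewrite -normr_le0 -f0.
exact: le_C0_norm.
Qed.

HB.instance Definition _ :=
  Lmodule_isNormed.Build R C0 C0_ler_normD C0_normrZ C0_normr0_eq0.

Definition C0_le f g : bool := `[< forall w, f w <= g w >].
Definition C0_lt f g : bool := (g != f) && C0_le f g.
Definition C0_meet f g : C0 := MkC0 (is_c0_min (C0_funP f) (C0_funP g)).
Definition C0_join f g : C0 := MkC0 (is_c0_max (C0_funP f) (C0_funP g)).

Lemma C0_le_def f g : C0_le f g = (C0_meet f g == f).
Proof.
apply/asboolP/eqP => [fg|<- w]; last by rewrite /= ge_min lexx orbT.
by apply: C0P => w; apply/min_idPl/fg.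
Qed.

Fact C0_display : Order.disp_t. Proof. exact: (Order.Disp tt tt). Qed.

Lemma C0_meetC : commutative C0_meet.
Proof. by move=> f g; apply: C0P => w; exact: minC. Qed.
Lemma C0_joinC : commutative C0_join.
Proof. by move=> f g; apply: C0P => w; exact: maxC. Qed.
Lemma C0_meetA : associative C0_meet.
Proof. by move=> f g h; apply: C0P => w; exact: minA. Qed.
Lemma C0_joinA : associative C0_join.
Proof. by move=> f g h; apply: C0P => w; exact: maxA. Qed.
Lemma C0_joinKI g f : C0_meet f (C0_join f g) = f.
Proof. by apply: C0P => w; exact: maxKx. Qed.
Lemma C0_meetKU g f : C0_join f (C0_meet f g) = f.
Proof. by apply: C0P => w; exact: minKx. Qed.
Lemma C0_meetUl : left_distributive C0_meet C0_join.
Proof. by move=> f g h; apply: C0P => w; exact: min_maxl. Qed.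
Lemma C0_meetxx : idempotent_op C0_meet.
Proof. by move=> f; apply: C0P => w; exact: minxx. Qed.

HB.instance Definition _ := Order.isMeetJoinDistrLattice.Build C0_display C0
  C0_le_def (fun _ _ => erefl) C0_meetC C0_joinC C0_meetA C0_joinA
  C0_joinKI C0_meetKU C0_meetUl C0_meetxx.

End C0.


Section LatticeAutomorphisms.
Variables (R : realType) (Omega : topologicalType).
Local Notation E := (C0 R Omega).

Record lattice_hom (T : E -> E) : Prop := LatticeHom {
  lattice_hom_linear : linear T;
  lattice_hom_meet : {morph T : f g / Order.meet f g};
  lattice_hom_join : {morph T : f g / Order.join f g} }.

(* No continuity is required: a lattice homomorphism between Banach lattices
   is automatically bounded. *)
Record LatAut : Type := MkLatAut {
  LatAut_fun :> E -> E;
  LatAut_inv : E -> E;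
  LatAut_hom : lattice_hom LatAut_fun;
  LatAut_funK : cancel LatAut_fun LatAut_inv;
  LatAut_invK : cancel LatAut_inv LatAut_fun }.

Lemma LatAutP (S T : LatAut) : (forall f, S f = T f) -> S = T.
Proof.
case: S T => [S S' hS SK S'K] [T T' hT TK T'K] /= /funext ST.
have ST' : S' = T' by apply/funext => f; rewrite -{1}(T'K f) -ST SK.
by subst T T'; congr MkLatAut; exact: Prop_irrelevance.
Qed.

HB.instance Definition _ := gen_eqMixin LatAut.
HB.instance Definition _ := gen_choiceMixin LatAut.

Lemma lattice_hom_id : lattice_hom idfun.
Proof. by split. Qed.

Lemma lattice_hom_comp S T :
  lattice_hom S -> lattice_hom T -> lattice_hom (S \o T).
Proof.
move=> [lS mS jS] [lT mT jT]; split.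
- by move=> a f g; rewrite /= lT lS.
- by move=> f g; rewrite /= mT mS.
- by move=> f g; rewrite /= jT jS.
Qed.

Lemma lattice_hom_inv S T :
  cancel S T -> cancel T S -> lattice_hom S -> lattice_hom T.
Proof.
move=> SK TK [lS mS jS]; split.
- by move=> a f g; apply: (can_inj SK); rewrite lS !TK.
- by move=> f g; apply: (can_inj SK); rewrite mS !TK.
- by move=> f g; apply: (can_inj SK); rewrite jS !TK.
Qed.

Definition LatAut_one : LatAut :=
  @MkLatAut idfun idfun lattice_hom_id (fun=> erefl) (fun=> erefl).

Definition LatAut_mul (S T : LatAut) : LatAut :=
  @MkLatAut (S \o T) (LatAut_inv T \o LatAut_inv S)
    (lattice_hom_comp (LatAut_hom S) (LatAut_hom T))
    (can_comp (@LatAut_funK S) (@LatAut_funK T))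
    (can_comp (@LatAut_invK T) (@LatAut_invK S)).

Definition LatAut_opp (T : LatAut) : LatAut :=
  @MkLatAut (LatAut_inv T) T
    (lattice_hom_inv (@LatAut_funK T) (@LatAut_invK T) (LatAut_hom T))
    (@LatAut_invK T) (@LatAut_funK T).

Lemma LatAut_mulA : associative LatAut_mul.
Proof. by move=> S T U; exact: LatAutP. Qed.
Lemma LatAut_mul1 : left_id LatAut_one LatAut_mul.
Proof. by move=> T; exact: LatAutP. Qed.
Lemma LatAut_mulr1 : right_id LatAut_one LatAut_mul.
Proof. by move=> T; exact: LatAutP. Qed.
Lemma LatAut_mulV : left_inverse LatAut_one LatAut_opp LatAut_mul.
Proof. by move=> T; apply: LatAutP => f; exact: LatAut_funK. Qed.
Lemma LatAut_mulrV : right_inverse LatAut_one LatAut_opp LatAut_mul.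
Proof. by move=> T; apply: LatAutP => f; exact: LatAut_invK. Qed.

HB.instance Definition _ := isGroup.Build LatAut
  LatAut_mulA LatAut_mul1 LatAut_mulr1 LatAut_mulV LatAut_mulrV.

(* The strong operator topology: pointwise convergence of operators, for the
   norm topology of [C0 R Omega]. *)
HB.instance Definition _ := Topological.copy LatAut
  (initial_topology (LatAut_fun : LatAut -> {ptws E -> E})).

End LatticeAutomorphisms.

Section Homeomorphisms.
Variable Omega : topologicalType.

Record homeo : Type := MkHomeo {
  homeo_fun :> Omega -> Omega;
  homeo_inv : Omega -> Omega;
  homeo_funK : cancel homeo_fun homeo_inv;
  homeo_invK : cancel homeo_inv homeo_fun;
  homeo_fun_continuous : continuous homeo_fun;
  homeo_inv_continuous : continuous homeo_inv }.

Lemma homeoP (phi psi : homeo) : (forall w, phi w = psi w) -> phi = psi.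
Proof.
case: phi psi => [f f' fK f'K cf cf'] [g g' gK g'K cg cg'] /= /funext fg.
have fg' : f' = g' by apply/funext => w; rewrite -{1}(g'K w) -fg fK.
by subst g g'; congr MkHomeo; exact: Prop_irrelevance.
Qed.

Lemma homeo_comp_continuous (f g : Omega -> Omega) :
  continuous f -> continuous g -> continuous (f \o g).
Proof. by move=> cf cg w; apply: continuous_comp; [exact: cg|exact: cf]. Qed.

Definition homeo_one : homeo :=
  @MkHomeo idfun idfun (fun=> erefl) (fun=> erefl) (fun=> @cvg_id _ _)
    (fun=> @cvg_id _ _).

Definition homeo_mul (phi psi : homeo) : homeo :=
  @MkHomeo (phi \o psi) (homeo_inv psi \o homeo_inv phi)
    (can_comp (@homeo_funK phi) (@homeo_funK psi))
    (can_comp (@homeo_invK psi) (@homeo_invK phi))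
    (homeo_comp_continuous (@homeo_fun_continuous phi)
      (@homeo_fun_continuous psi))
    (homeo_comp_continuous (@homeo_inv_continuous psi)
      (@homeo_inv_continuous phi)).

Definition homeo_opp (phi : homeo) : homeo :=
  MkHomeo (@homeo_invK phi) (@homeo_funK phi)
    (@homeo_inv_continuous phi) (@homeo_fun_continuous phi).

Lemma homeo_mulA : associative homeo_mul.
Proof. by move=> phi psi chi; exact: homeoP. Qed.
Lemma homeo_mul1 : left_id homeo_one homeo_mul.
Proof. by move=> phi; exact: homeoP. Qed.
Lemma homeo_mulr1 : right_id homeo_one homeo_mul.
Proof. by move=> phi; exact: homeoP. Qed.
Lemma homeo_mulV : left_inverse homeo_one homeo_opp homeo_mul.
Proof. by move=> phi; apply: homeoP => w; exact: homeo_funK. Qed.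
Lemma homeo_mulrV : right_inverse homeo_one homeo_opp homeo_mul.
Proof. by move=> phi; apply: homeoP => w; exact: homeo_invK. Qed.

End Homeomorphisms.

Section HomeoGroup.
Variables (R : realType) (Omega : topologicalType).

(* [Homeo R Omega] depends on [R] because its topology is induced from
   operators on the space of [R]-valued functions [C0 R Omega]. *)
Definition Homeo : Type := let _ := R in homeo Omega.

HB.instance Definition _ := gen_eqMixin Homeo.
HB.instance Definition _ := gen_choiceMixin Homeo.
HB.instance Definition _ := isGroup.Build Homeo
  (@homeo_mulA Omega) (@homeo_mul1 Omega) (@homeo_mulr1 Omega)
  (@homeo_mulV Omega) (@homeo_mulrV Omega).

Lemma is_c0_comp_homeo (f : C0 R Omega) (phi : homeo Omega) :
  f \o homeo_inv phi \in is_c0 R Omega.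
Proof.
apply/is_c0P; split.
  move=> w; apply: continuous_comp; first exact: homeo_inv_continuous.
  exact: C0_continuous.
move=> e e0; have -> : [set w | e <= `|(f \o homeo_inv phi) w|] =
    phi @` [set w | e <= `|f w|].
  apply/seteqP; split=> [w ew|_ [w ew <-]]; last by rewrite /= homeo_funK.
  by exists (homeo_inv phi w) => //; exact: homeo_invK.
apply: continuous_compact; last exact: C0_vanishing.
by apply: continuous_subspaceT; exact: homeo_fun_continuous.
Qed.

Definition homeo_op (phi : homeo Omega) (f : C0 R Omega) : C0 R Omega :=
  MkC0 (is_c0_comp_homeo f phi).

Lemma homeo_op_hom phi : lattice_hom (homeo_op phi).
Proof. by split=> [a f g|f g|f g]; exact: C0P. Qed.

Lemma homeo_opK phi : cancel (homeo_op phi) (homeo_op (homeo_opp phi)).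
Proof. by move=> f; apply: C0P => w; rewrite /= homeo_funK. Qed.

Lemma homeo_opVK phi : cancel (homeo_op (homeo_opp phi)) (homeo_op phi).
Proof. by move=> f; apply: C0P => w; rewrite /= homeo_invK. Qed.

Definition homeo_aut (phi : Homeo) : LatAut R Omega :=
  MkLatAut (homeo_op_hom phi) (homeo_opK phi) (homeo_opVK phi).

HB.instance Definition _ := Topological.copy Homeo (initial_topology homeo_aut).

Lemma homeo_autM : {morph homeo_aut : phi psi / (phi * psi)%g}.
Proof. by move=> phi psi; apply: LatAutP => f; exact: C0P. Qed.

End HomeoGroup.

Section Multipliers.
Variables (R : realType) (Omega : topologicalType).

Record Cb_pp : Type := MkCbpp {
  Cb_pp_fun :> Omega -> R;
  Cb_pp_continuous : continuous Cb_pp_fun;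
  Cb_pp_bounded : bounded_fun Cb_pp_fun;
  Cb_pp_ge : exists2 delta : R, 0 < delta & forall w, delta <= Cb_pp_fun w }.

Implicit Types m : Cb_pp.

Lemma Cb_pp_gt0 m w : 0 < m w.
Proof. by have [d d0 dm] := Cb_pp_ge m; exact: lt_le_trans (dm w). Qed.

Lemma Cb_pp_inv_continuous m : continuous (fun w => (m w)^-1).
Proof.
by move=> w; apply: cvgV; [rewrite gt_eqF ?Cb_pp_gt0|exact: Cb_pp_continuous].
Qed.

Lemma Cb_pp_inv_bounded m : bounded_fun (fun w => (m w)^-1).
Proof.
have [d d0 dm] := Cb_pp_ge m; exists d^-1; split; first exact: num_real.
move=> x dx w _ /=; rewrite ger0_norm ?invr_ge0 ?(ltW (Cb_pp_gt0 m w))//.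
by rewrite (le_trans _ (ltW dx))// lef_pV2 ?posrE ?Cb_pp_gt0.
Qed.

Lemma Cb_pp_inv_ge m :
  exists2 delta : R, 0 < delta & forall w, delta <= (m w)^-1.
Proof.
have [M [_ /(_ (`|M| + 1))]] := Cb_pp_bounded m.
have -> : M < `|M| + 1 by rewrite (le_lt_trans (ler_norm M))// ltrDl.
move=> /(_ isT) H; exists (`|M| + 1)^-1; first by rewrite invr_gt0 ltr_wpDl.
move=> w; rewrite lef_pV2 ?posrE ?Cb_pp_gt0 ?ltr_wpDl//.
by rewrite (le_trans (ler_norm _))//; exact: H.
Qed.

Definition Cb_pp_inv m : Cb_pp :=
  MkCbpp (@Cb_pp_inv_continuous m) (Cb_pp_inv_bounded m) (Cb_pp_inv_ge m).

Lemma is_c0_mul m (f : C0 R Omega) : (fun w => m w * f w) \in is_c0 R Omega.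
Proof.
have cmf : continuous (fun w => m w * f w).
  move=> w; apply: (@cvgM _ _ _ _ m f).
    exact: Cb_pp_continuous.
  exact: C0_continuous.
apply/is_c0P; split=> //; have [M [_ /(_ (`|M| + 1))]] := Cb_pp_bounded m.
have -> : M < `|M| + 1 by rewrite (le_lt_trans (ler_norm M))// ltrDl.
have M1 : 0 < `|M| + 1 by rewrite ltr_wpDl.
move=> /(_ isT) H; apply: vanishing_of_subset => // e e0.
exists [set w | e / (`|M| + 1) <= `|f w|].
  by apply: C0_vanishing; rewrite divr_gt0.
move=> w /= ew; rewrite ler_pdivrMr// (le_trans ew)// normrM mulrC.
by rewrite ler_wpM2l//; exact: H.
Qed.

Definition mult_op m (f : C0 R Omega) : C0 R Omega := MkC0 (is_c0_mul m f).

Lemma mult_op_hom m : lattice_hom (mult_op m).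
Proof.
have m0 w : 0 <= m w := ltW (Cb_pp_gt0 m w).
split=> [a f g|f g|f g]; apply: C0P => w.
- by rewrite /= mulrDr mulrCA.
- exact: minr_pMr.
- exact: maxr_pMr.
Qed.

Lemma mult_opK m : cancel (mult_op m) (mult_op (Cb_pp_inv m)).
Proof. by move=> f; apply: C0P => w; rewrite /= mulKf// gt_eqF ?Cb_pp_gt0. Qed.

Lemma mult_opVK m : cancel (mult_op (Cb_pp_inv m)) (mult_op m).
Proof. by move=> f; apply: C0P => w; rewrite /= mulVKf// gt_eqF ?Cb_pp_gt0. Qed.

Definition mult_aut m : LatAut R Omega :=
  MkLatAut (mult_op_hom m) (mult_opK m) (mult_opVK m).

End Multipliers.

Section Projection.
Variables (R : realType) (Omega : topologicalType).

(* [p_homeo (m phi) = phi].  For locally compact Hausdorff [Omega] every lattice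
   automorphism has exactly one decomposition [m phi], so the default value
   [1] of [xget] is never used. *)
Definition p_homeo (T : LatAut R Omega) : Homeo R Omega :=
  xget 1%g [set phi : Homeo R Omega |
    exists m : Cb_pp R Omega, T = (mult_aut m * homeo_aut phi)%g].

End Projection.

(* Main.v *)
Require Import Defs.
From mathcomp Require Import all_boot all_order all_algebra.
From mathcomp Require Import ring lra.
From mathcomp Require Import all_classical all_reals all_analysis.
Import Order.TTheory GRing.Theory Num.Theory.
Import numFieldNormedType.Exports.
Local Open Scope classical_set_scope.
Local Open Scope ring_scope.

(* Write [T = m_T p(T)] (Banach-Stone).  Compactness bounds every orbit [G f] in
   norm, hence bounds the weights [m_T], [T] in [G], uniformly from above, and
   also from below because [G] is closed under inversion.  If [S] is near [T]
   in [G], then [m_S (p(S) g)] is uniformly close to [m_T (p(T) g)] for both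
   [g = f] and [g = f^2]; cross-multiplying eliminates the weights and shows
   that the product of [p(S) f], [p(T) f] and [p(S) f - p(T) f] is uniformly
   small.  Since the weights are bounded above and below, where one of
   [p(S) f], [p(T) f] is large so is the other, and [p(S) f] is uniformly close
   to [p(T) f]. *)

(** * Functions in [C0] and functionals on it *)

Lemma is_c0_uniform_limit (R : realType) (Omega : topologicalType)
    (f : Omega -> R) :
  (forall e : R, 0 < e -> exists g : C0 R Omega, forall w, `|f w - g w| <= e) ->
  f \in is_c0 R Omega.
Proof.
move=> fg; have cf : continuous f.
  move=> w; apply/cvgrPdist_le => e e0.
  have e3 : 0 < e / 3 by rewrite divr_gt0.
  have [g gP] := fg _ e3; have := @C0_continuous _ _ g w.
  move=> /cvgrPdist_le/(_ _ e3); apply: filterS => v gwv.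
  rewrite (_ : f w - f v = (f w - g w) + (g w - g v) - (f v - g v));
    last by ring.
  rewrite (le_trans (ler_normB _ _))//.
  rewrite (_ : e = e / 3 + e / 3 + e / 3); last by field.
  apply: lerD; last exact: gP.
  by apply: (le_trans (ler_normD _ _)); apply: lerD; first exact: gP.
apply/is_c0P; split => //; apply: vanishing_of_subset => // e e0.
have e2 : 0 < e / 2 by rewrite divr_gt0.
have [g gP] := fg _ e2; exists [set w | e / 2 <= `|g w|].
  exact: C0_vanishing.
move=> w /= ew; have := gP w; have := ler_normD (f w - g w) (g w).
by rewrite subrK; lra.
Qed.

(* Gliding hump: functions [f_ n] violating the bound ever more strongly are
   merged into [sup_n f_ n / (n + 1)], at which the functionals are unbounded. *)
Lemma positive_functionals_bounded (R : realType) (Omega : topologicalType)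
    (L : set (C0 R Omega -> R)) :
  (forall l, L l -> forall f g : C0 R Omega,
    (forall w, f w <= g w) -> l f <= l g) ->
  (forall l, L l -> forall a f, l (a *: f) = a * l f) ->
  (forall f, exists M : R, forall l, L l -> l f <= M) ->
  exists M : R, forall l (f : C0 R Omega),
    L l -> (forall w, 0 <= f w <= 1) -> l f <= M.
Proof.
move=> Lmono LZ Lbnd; apply: contrapT => noM.
(* The square survives the division by [n + 1] in the merged function: [l (c n *: f n)] still
   exceeds [n + 1]. *)
have /choice[lf lfP] : forall n : nat,
    exists lf : (C0 R Omega -> R) * C0 R Omega,
    [/\ L lf.1, forall w, 0 <= lf.2 w <= 1 & n.+1%:R ^+ 2 < lf.1 lf.2].
  move=> n; apply: contrapT => H; apply: noM.
  exists (n.+1%:R ^+ 2) => l f Ll f01.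
  by rewrite leNgt; apply/negP => lfn; apply: H; exists (l, f).
pose c n : R := n.+1%:R^-1.
have c0 n : 0 < c n by rewrite invr_gt0.
have c_le m n : (m <= n)%N -> c n <= c m.
  by move=> mn; rewrite lef_pV2 ?posrE// ler_nat.
pose f n := (lf n).2.
have f0 n w : 0 <= f n w by have [_ /(_ w)/andP[]] := lfP n.
have f1 n w : f n w <= 1 by have [_ /(_ w)/andP[]] := lfP n.
have cf0 n w : 0 <= c n * f n w by rewrite mulr_ge0// ltW.
have cf_le n w : c n * f n w <= c n by rewrite ler_piMr// ltW.
pose F w := sup (range (fun n => c n * f n w)).
have Fub n w : c n * f n w <= F w.
  apply: ub_le_sup; last by exists n.
  by exists (c 0%N) => _ [k _ <-]; rewrite (le_trans (cf_le _ _))// c_le.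
have Fle w M : (forall n, c n * f n w <= M) -> F w <= M.
  move=> H; apply: ge_sup; last by move=> _ [k _ <-].
  by exists (c 0%N * f 0%N w); exists 0%N.
(* Finite joins stay in [C0]; the terms omitted from [h n] are at most [c n], so [h n] tends to [F]
   uniformly. *)
pose h := fix h n := if n is k.+1 then C0_join (h k) (c k *: f k) else 0.
have hS n w : h n.+1 w = Num.max (h n w) (c n * f n w) by [].
have h0 n w : 0 <= h n w.
  by elim: n => [|n IH]; [exact: lexx|rewrite hS le_max IH].
have h_ub n k w : (k < n)%N -> c k * f k w <= h n w.
  elim: n => // n IH; rewrite ltnS leq_eqVlt hS le_max.
  by move=> /orP[/eqP->|/IH ->//]; rewrite lexx orbT.
have h_le n w : h n w <= F w.
  elim: n => [|n IH]; last by rewrite hS ge_max IH Fub.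
  exact: le_trans (cf0 0%N w) (Fub _ _).
have FC0 : F \in is_c0 R Omega.
  apply: is_c0_uniform_limit => e e0.
  have [n ne] : exists n, c n <= e.
    exists (Num.truncn e^-1).
    rewrite /c -[leRHS]invrK lef_pV2 ?posrE ?invr_gt0//.
    exact/ltW/truncnS_gt.
  exists (h n) => w; rewrite ger0_norm ?subr_ge0// lerBlDr.
  apply: Fle => k; have [kn|nk] := ltnP k n.
    by rewrite (le_trans (h_ub _ _ _ kn))// lerDr ltW.
  by rewrite -[leLHS]addr0 lerD// (le_trans (cf_le _ _))//
    (le_trans (c_le _ _ nk)).
have [M MP] := Lbnd (MkC0 FC0).
pose n := Num.truncn M.
have [Ll _ nl] := lfP n.
have := MP _ Ll; rewrite leNgt => /negP; apply.
apply: (@lt_le_trans _ _ ((lf n).1 (c n *: f n))); last first.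
  by apply: Lmono => // w; exact: Fub.
rewrite LZ// mulrC ltr_pdivlMr//; apply: le_lt_trans nl.
by rewrite expr2 ler_pM2r//; exact/ltW/truncnS_gt.
Qed.

(** With [K] a compact neighbourhood of [w], complete regularity separates [w] from the complement
    of [U° ∩ K°]; one minus the separating function vanishes off [K], hence lies in [C0]. *)
Lemma C0_bump (R : realType) (Omega : topologicalType) (w : Omega)
    (U : set Omega) :
  locally_compact [set: Omega] -> hausdorff_space Omega -> nbhs w U ->
  exists f : C0 R Omega,
    [/\ f w = 1, forall v, 0 <= f v <= 1 & forall v, ~ U v -> f v = 0].
Proof.
move=> lc hO Uw; have [K Kw [cK _]] := lc w I.
have {}Kw : nbhs w K by move: Kw; apply: (@filterS _ (nbhs w)) => v; apply.
pose V := U° `&` K°.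
have Vw : V w by split.
have oV : open V by apply: openI; exact: open_interior.
have /(_ (~` V)) := @locally_compact_completely_regular _ R lc hO w.
move=> /(_ (open_closedC oV)).
have nVw : ~ (~` V) w by apply.
move=> /(_ nVw)/(@uniform_separatorP _ R)[g [cg g01 gw gV]].
have gw0 : g w = 0 by apply: gw; exists w.
have gV1 v : ~ V v -> g v = 1 by move=> Vv; apply: gV; exists v.
have cf : continuous (fun v => 1 - g v).
  by move=> v; apply: cvgB; [exact: cvg_cst|exact: cg].
have fC0 : (fun v => 1 - g v) \in is_c0 R Omega.
  apply/is_c0P; split => //; apply: vanishing_of_subset => // e e0.
  exists K => // v /= ev; have [[_ /interior_subset//]|nV] := pselect (V v).
  by move: ev; rewrite gV1// subrr normr0 leNgt e0.
exists (MkC0 fC0); split => /=.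
- by rewrite gw0 subr0.
- move=> v; have : `[0, 1]%classic (g v) by apply: g01; exists v.
  by rewrite /= in_itv/= => /andP[g0 g1]; rewrite subr_ge0 g1 gerBl.
- by move=> v Uv; rewrite gV1 ?subrr// => -[/interior_subset].
Qed.

(* The sets [{h >= e}], for [h] in the family [A] below, form a filter base on
   the compact [{g >= e}]; at a cluster point [x] no [h] in [A] can vanish. *)
Lemma lattice_functional_support (R : realType) (Omega : topologicalType)
    (l : C0 R Omega -> R) (M : R) :
  (forall a f g, l (a *: f + g) = a * l f + l g) ->
  (forall f g, l (C0_meet f g) = Num.min (l f) (l g)) ->
  (forall f g, l (C0_join f g) = Num.max (l f) (l g)) ->
  (forall f : C0 R Omega, (forall w, 0 <= f w <= 1) -> l f <= M) ->
  (exists f, l f <> 0) ->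
  exists x, forall f : C0 R Omega, f x = 0 -> l f = 0.
Proof.
move=> llin lmeet ljoin lM [g0 lg0]; apply: contrapT => nox.
have l0 : l 0 = 0.
  by have := llin (-1) 0 0; rewrite scaler0 addr0 mulN1r addNr.
have lZ a f : l (a *: f) = a * l f by rewrite -[a *: f]addr0 llin l0 addr0.
(* The witness is [|f| / |l f|]: the join of [f] and [-f] is [|f|], and [l |f| = |l f|]. *)
have normalize (f : C0 R Omega) : l f <> 0 -> exists h : C0 R Omega,
    [/\ l h = 1, forall w, 0 <= h w & forall w, f w = 0 -> h w = 0].
  move=> lf; exists (`|l f|^-1 *: C0_join f ((-1) *: f)); split.
  - rewrite lZ ljoin lZ mulN1r maxrN mulVf//.
    by rewrite normr_eq0; exact/eqP.
  - move=> w; change (0 <= `|l f|^-1 * Num.max (f w) (-1 * f w)).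
    by rewrite mulN1r maxrN mulr_ge0.
  - move=> w fw; change (`|l f|^-1 * Num.max (f w) (-1 * f w) = 0).
    by rewrite mulN1r maxrN fw normr0 mulr0.
have [g [lg g_ge0 _]] := normalize _ lg0.
(* This threshold makes every [h] in [A] reach [e] somewhere: otherwise [e^-1 *: h] takes values in
   [[0, 1]], and [l h = 1] forces [|M| + 1 <= M]. *)
pose e := (`|M| + 1)^-1; have e0 : 0 < e by rewrite invr_gt0 ltr_wpDl.
pose A := [set h : C0 R Omega | [/\ l h = 1, forall w, 0 <= h w &
  forall w, h w <= g w]].
pose S (h : C0 R Omega) := [set w | e <= h w].
have Ameet h k : A h -> (l k = 1) -> (forall w, 0 <= k w) -> A (C0_meet h k).
  move=> [lh h0 hg] lk k0; split=> [|w|w] /=.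
  - by rewrite lmeet lh lk minxx.
  - by rewrite le_min h0 k0.
  - by rewrite ge_min hg.
have Ag : A g by split.
have FF : Filter (filter_from A S).
  apply: filter_from_filter; first by exists g.
  move=> h k Ah [lk k0 _]; exists (C0_meet h k); first exact: Ameet.
  by move=> w; rewrite /S /= le_min => /andP[].
have PF : ProperFilter (filter_from A S).
  apply: filter_from_proper => h [lh h0 _]; apply: contrapT => Sh.
  have : l (e^-1 *: h) <= M.
    apply: lM => w; change (0 <= e^-1 * h w <= 1).
    rewrite mulr_ge0//= ?invr_ge0 ?(ltW e0)// mulrC ler_pdivrMr// mul1r.
    by rewrite leNgt; apply/negP => /ltW ehw; apply: Sh; exists w.
  by rewrite lZ lh mulr1 /e invrK; have := ler_norm M; lra.
have cK := @C0_vanishing R Omega g e e0.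
have [|x [_ clx]] := cK (filter_from A S) PF.
  by exists g => // w /= ew; rewrite (le_trans ew)// ler_norm.
apply: nox; exists x => f fx0; apply: contrapT => /normalize[k [lk k0 fk]].
have kx := fk _ fx0.
(* The meet with [g] brings [k] into the family [A], whose sets [S] must meet every neighbourhood of
   [x]. *)
have Agk := Ameet _ _ Ag lk k0.
have : nbhs x [set w | k w < e].
  by apply: (@cvgr_lt _ _ _ _ k (k x)); [exact: C0_continuous|rewrite kx].
move=> /(clx (S (C0_meet g k))) [|w []].
  by exists (C0_meet g k).
rewrite /S /= le_min => /andP[_] ekw kwe.
by have := lt_le_trans kwe ekw; rewrite ltxx.
Qed.

(** * Lattice automorphisms as weighted point evaluations *)

Section LatticeAutomorphisms.
Variables (R : realType) (Omega : topologicalType).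
Implicit Types (T : LatAut R Omega) (f g : C0 R Omega) (w x : Omega).

Lemma LatAut_linE T a f g w : T (a *: f + g) w = a * T f w + T g w.
Proof. by rewrite (lattice_hom_linear (LatAut_hom T)). Qed.

Lemma LatAut_ZE T a f w : T (a *: f) w = a * T f w.
Proof.
have T0 : T 0 w = 0.
  by have := LatAut_linE T (-1) 0 0 w; rewrite scaler0 addr0 mulN1r addNr.
by rewrite -[a *: f]addr0 LatAut_linE T0 addr0.
Qed.

Lemma LatAut_mono T f g w : (forall v, f v <= g v) -> T f w <= T g w.
Proof.
move=> fg; have fgE : Order.meet f g = f.
  by apply: C0P => v; apply/min_idPl/fg.
rewrite -{1}fgE (lattice_hom_meet (LatAut_hom T)).
by change (Num.min (T f w) (T g w) <= T g w); rewrite ge_min lexx orbT.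
Qed.

(** Uniform boundedness for the positive functionals [f |-> T f w], jointly in [T] and [w]. For a
    singleton [F] it is the automatic boundedness of one automorphism. *)
Lemma LatAut_pointwise_bounded (F : set (LatAut R Omega)) :
  (forall f, exists M : R, forall T, F T -> `|T f| <= M) ->
  exists M : R, forall T f w, F T -> (forall v, 0 <= f v <= 1) -> T f w <= M.
Proof.
move=> Fb.
pose L := [set l | exists T w, F T /\ l = fun f => (T : LatAut R Omega) f w].
have [|||M MP] := @positive_functionals_bounded _ _ L.
- by move=> _ [T [w [_ ->]]] f g; exact: LatAut_mono.
- by move=> _ [T [w [_ ->]]] a f; exact: LatAut_ZE.
- move=> f; have [M MP] := Fb f; exists M => _ [T [w [FT ->]]].
  rewrite (le_trans (ler_norm _))// (le_trans (le_C0_norm _ _))//.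
  exact: MP.
- by exists M => T f w FT; apply: (MP (fun f => T f w)); exists T, w.
Qed.

Hypothesis lcO : locally_compact [set: Omega].
Hypothesis hO : hausdorff_space Omega.

Lemma C0_one x : exists f, f x = 1 /\ forall v, 0 <= f v <= 1.
Proof.
have [f [fx f01 _]] := @C0_bump R _ x setT lcO hO filterT.
by exists f.
Qed.

(** A bump at [y] that vanishes at [x <> y] would violate the identity. The factor [c] absorbs the
    weights. *)
Lemma C0_separates (c : R) x y : (forall f, c * f x = f y) -> x = y.
Proof.
move=> H; apply: contrapT => xy.
have Uy : nbhs y (~` [set x]).
  apply: open_nbhs_nbhs; split; last exact/nesym.
  by apply: closed_openC; exact/accessible_closed_set1/hausdorff_accessible.
have [f [fy _ fU]] := @C0_bump R _ y _ lcO hO Uy.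
have := H f; rewrite fy fU ?mulr0; last by apply.
by move/eqP; rewrite eq_sym oner_eq0.
Qed.

(** The functional [f |-> T f w] kills every function vanishing at a suitable point [x]. If
    [u x = 1], this applies to [f - f x *: u], whence [T f w = T u w * f x]. *)
Lemma LatAut_dirac T w : exists xc : Omega * R,
  0 < xc.2 /\ forall f, T f w = xc.2 * f xc.1.
Proof.
have Tw0 : exists f, T f w <> 0.
  have [u [uw _]] := C0_one w; exists (LatAut_inv T u).
  by rewrite LatAut_invK uw; apply/eqP; rewrite oner_eq0.
have [|M MP] := @LatAut_pointwise_bounded [set T].
  by move=> f; exists `|T f| => _ ->.
have [|||||x xP] := @lattice_functional_support _ _ (fun f => T f w) M.
- by move=> a f g; exact: LatAut_linE.
- by move=> f g; rewrite -[C0_meet f g]/(Order.meet f g)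
    (lattice_hom_meet (LatAut_hom T)).
- by move=> f g; rewrite -[C0_join f g]/(Order.join f g)
    (lattice_hom_join (LatAut_hom T)).
- by move=> f; exact: MP.
- exact: Tw0.
have [u [ux u01]] := C0_one x.
have TE f : T f w = T u w * f x.
  have := xP (- f x *: u + f); rewrite LatAut_linE.
  change ((- f x * u x + f x = 0 -> - f x * T u w + T f w = 0) ->
    T f w = T u w * f x).
  by rewrite ux mulr1 addNr => /(_ erefl); lra.
exists (x, T u w); split => //=.
rewrite lt0r; apply/andP; split.
  by apply/eqP => Tuw; have [f] := Tw0; rewrite TE Tuw mul0r.
rewrite -(mul0r (T u w)) -(LatAut_ZE T 0 u w) LatAut_mono// => v.
by rewrite scale0r; case/andP: (u01 v).
Qed.

End LatticeAutomorphisms.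

(** * The Banach-Stone decomposition *)

Section BanachStone.
Variables (R : realType) (Omega : topologicalType).
Implicit Types (T : LatAut R Omega) (f g : C0 R Omega) (w x : Omega).
Hypothesis lcO : locally_compact [set: Omega].
Hypothesis hO : hausdorff_space Omega.

Lemma LatAut_weight_bounded T (psi : Omega -> Omega) (m : Omega -> R) (M : R) :
  (forall f w, T f w = m w * f (psi w)) ->
  (forall f w, (forall v, 0 <= f v <= 1) -> T f w <= M) ->
  forall w, m w <= M.
Proof.
move=> TE TM w; have [u [uw u01]] := C0_one R _ lcO hO (psi w).
by have := TM u w u01; rewrite TE uw mulr1.
Qed.

(** For a bump [f] at [psi w] vanishing off [U], [psi] maps the open set where [T f > 0] into [U].
    Near [w], [m] is the quotient of [T f] by [f \o psi]. *)
Lemma weighted_comp_continuous T (psi : Omega -> Omega) (m : Omega -> R) :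
  (forall w, 0 < m w) -> (forall f w, T f w = m w * f (psi w)) ->
  continuous psi /\ continuous m.
Proof.
move=> m0 TE; have cpsi : continuous psi.
  move=> w U Uw; have [f [fw _ fU]] := @C0_bump R _ _ _ lcO hO Uw.
  have Tf0 : 0 < T f w by rewrite TE fw mulr1.
  have : nbhs w [set v | 0 < T f v].
    by apply: (@cvgr_gt _ _ _ _ (T f) (T f w)) => //; exact: C0_continuous.
  apply: filterS => v; rewrite /= TE => Tfv; apply: contrapT => /fU fv0.
  by move: Tfv; rewrite fv0 mulr0 ltxx.
split => // w; have [f [fw _]] := C0_one R _ lcO hO (psi w).
have cfpsi : f (psi v) @[v --> w] --> f (psi w).
  by apply: (continuous_comp (cpsi w)); exact: C0_continuous.
have fpsi : nbhs w [set v | 0 < f (psi v)].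
  by apply: (@cvgr_gt _ _ _ _ (f \o psi) (f (psi w))) => //; rewrite fw.
have : (T f v / f (psi v)) @[v --> w] --> T f w / f (psi w).
  apply: cvgM; first exact: C0_continuous.
  by apply: cvgV; rewrite ?fw ?oner_eq0// -fw.
rewrite [X in _ --> X](_ : _ = m w); last by rewrite TE fw mulr1 divr1.
apply: cvg_trans; apply: near_eq_cvg; apply: filterS fpsi => v /= fv.
by rewrite TE mulfK// gt_eqF.
Qed.

(** Both [T] and its inverse are weighted compositions; since they cancel, separation of points
    makes the point maps mutually inverse and the weights reciprocal. *)
Lemma LatAut_decomposition T : exists (phi : Homeo R Omega) (m : Cb_pp R Omega),
  T = (mult_aut m * homeo_aut phi)%g.
Proof.
have dirac (S : LatAut R Omega) : exists pm : (Omega -> Omega) * (Omega -> R),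
    (forall w, 0 < pm.2 w) /\ forall f w, S f w = pm.2 w * f (pm.1 w).
  have /choice[xc xcP] := LatAut_dirac _ _ lcO hO S.
  exists (fun w => (xc w).1, fun w => (xc w).2); split=> [w|f w].
    by have [] := xcP w.
  by have [_] := xcP w; apply.
have [[psi m] /= [m0 TE]] := dirac T.
have [[phi m'] /= [m'0 TVE]] := dirac (LatAut_opp T).
have mm w : m w * m' (psi w) = 1 /\ phi (psi w) = w.
  have E f : m w * m' (psi w) * f (phi (psi w)) = f w.
    by rewrite -mulrA -TVE -TE /= LatAut_invK.
  have H := C0_separates _ _ lcO hO _ _ _ E; split => //.
  have [u [uw _]] := C0_one R _ lcO hO w.
  by have := E u; rewrite H uw mulr1.
have psiphi w : psi (phi w) = w.
  apply: (C0_separates R _ lcO hO (m' w * m (phi w))) => f.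
  by rewrite -mulrA -TE -TVE /= LatAut_funK.
have [cpsi cm] := weighted_comp_continuous _ _ _ m0 TE.
have [cphi _] := weighted_comp_continuous (LatAut_opp T) _ _ m'0 TVE.
have bnd (S : LatAut R Omega) : exists2 M : R, 0 < M &
    forall f w, (forall v, 0 <= f v <= 1) -> S f w <= M.
  have [|M MP] := @LatAut_pointwise_bounded _ _ [set S].
    by move=> f; exists `|S f| => _ ->.
  exists (`|M| + 1) => [|f w f01]; first by rewrite ltr_wpDl.
  have : S f w <= M by exact: MP.
  by have := ler_norm M; lra.
have [M M0 TM] := bnd T; have [N N0 TVN] := bnd (LatAut_opp T).
have mM := LatAut_weight_bounded _ _ _ _ TE TM.
have m'N := LatAut_weight_bounded (LatAut_opp T) _ _ _ TVE TVN.
have bm : bounded_fun m.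
  exists M; split; first exact: num_real.
  by move=> K MK w _ /=; rewrite gtr0_norm// (le_trans (mM w))// ltW.
(* An upper bound [N] for the weight of the inverse is a lower bound [N^-1] for [m]. *)
have gem : exists2 d : R, 0 < d & forall w, d <= m w.
  exists N^-1 => [|w]; first by rewrite invr_gt0.
  have -> : m w = (m' (psi w))^-1.
    by apply: divr1_eq; rewrite invrK; case: (mm w).
  by rewrite lef_pV2 ?posrE.
(* [psi] is the inverse component because a homeomorphism acts by composition with its inverse. *)
exists (@MkHomeo _ phi psi psiphi (fun w => (mm w).2) cphi cpsi).
exists (MkCbpp cm bm gem).
by apply: LatAutP => f; apply: C0P => w; rewrite TE.
Qed.

(** Existence of the decomposition excludes the default value of [xget]. *)
Lemma p_homeoE T : exists m : Cb_pp R Omega, forall f w,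
  T f w = m w * homeo_op (p_homeo T) f w.
Proof.
have [m E] : exists m, T = (mult_aut m * homeo_aut (p_homeo T))%g.
  exact: (@xgetPex _ 1%g _ (LatAut_decomposition T)).
by exists m => f w; rewrite [in LHS]E.
Qed.

End BanachStone.

(** * The strong operator topology *)

Section StrongTopology.
Variables (R : realType) (Omega : topologicalType).
Implicit Types (T : LatAut R Omega) (f g : C0 R Omega).

Lemma C0_sqr f : (fun w => f w ^+ 2) \in is_c0 R Omega.
Proof.
have cf : continuous (fun w => f w ^+ 2).
  by move=> w; apply: (@cvgM _ _ _ _ f f); exact: C0_continuous.
apply/is_c0P; split => //; apply: vanishing_of_subset => // e e0.
have B0 : 0 < `|f| + 1 by rewrite ltr_wpDl.
exists [set w | e / (`|f| + 1) <= `|f w|].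
  by apply: C0_vanishing; rewrite divr_gt0.
move=> w /= ew; rewrite ler_pdivrMr// (le_trans ew)// expr2 normrM.
by rewrite ler_wpM2l// (le_trans (le_C0_norm f w))// lerDl.
Qed.

Lemma continuous_LatAut_eval f : continuous (fun T => T f).
Proof.
move=> T; have := @initial_continuous (LatAut R Omega)
  {ptws C0 R Omega -> C0 R Omega} (@LatAut_fun R Omega) T.
move=> /pointwise_cvgP/(_ f); apply; apply: fmap_filter.
exact: (@nbhs_filter (LatAut R Omega) T).
Qed.

(** The topology of [Homeo] is pulled back twice, along [homeo_aut] and then from pointwise
    convergence of operators, so sup-norm convergence for each [f] suffices. *)
Lemma homeo_continuous_at (X : topologicalType) (F : set_system X)
    (p : X -> Homeo R Omega) (q : Homeo R Omega) : Filter F ->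
  (forall f (e : R), 0 < e -> \forall x \near F,
    forall w, `|homeo_op q f w - homeo_op (p x) f w| <= e) ->
  p x @[x --> F] --> q.
Proof.
move=> FF H.
have : (LatAut_fun (homeo_aut (p x)) : {ptws _ -> _}) @[x --> F] -->
    (LatAut_fun (homeo_aut q) : {ptws _ -> _}).
  apply/pointwise_cvgP => f; apply/cvgrPdist_le => e e0.
  apply: filterS (H f e e0) => x xP.
  by apply: C0_norm_le => //; exact: ltW.
move=> h U [_ [[_ [V oV <-] <-]]] /= Vq /filterS; apply; apply: h.
exact: open_nbhs_nbhs.
Qed.

End StrongTopology.

(** * Elimination of the weights *)

(* [m n a b (b - a) = (m b^2 - n a^2) n a - (m b - n a) n a^2], so [a] and [b]
   are close unless one of them is small; in that case both are. *)
Lemma weights_close (R : realType) (C B e : R) : 1 <= C -> 0 <= B -> 0 < e ->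
  exists2 d, 0 < d & forall m n a b : R,
    C^-1 <= m <= C -> C^-1 <= n <= C -> `|a| <= B ->
    `|m * b - n * a| <= d -> `|m * b ^+ 2 - n * a ^+ 2| <= d ->
    `|a - b| <= e.
Proof.
move=> C1 B0 e0; have C_gt0 : 0 < C by lra.
(* If [e / 2 <= |a|], then [e / (2 C) <= C |b| + d], and [d <= e / (4 C)] leaves [|b| >= e1];
   likewise with [a] and [b] exchanged. *)
pose e1 := e / (4 * C ^+ 2).
have e10 : 0 < e1 by rewrite divr_gt0// mulr_gt0// exprn_gt0.
pose D := C ^+ 3 * (B + B ^+ 2 + 1).
have D0 : 0 < D.
  by rewrite mulr_gt0 ?exprn_gt0// ltr_wpDl// addr_ge0// exprn_ge0.
(* The first entry serves that comparison of [a] and [b]; the second brings [upper] down to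
   [lower]. *)
pose d := Num.min (e / (4 * C)) (e * e1 ^+ 2 / D).
have d0 : 0 < d.
  by rewrite lt_min; apply/andP; split; rewrite divr_gt0// mulr_gt0// exprn_gt0.
have d_le1 : d <= e / (4 * C) by rewrite ge_min lexx.
have d_le2 : d <= e * e1 ^+ 2 / D by rewrite ge_min lexx orbT.
exists d => // m n a b /andP[Cm mC] /andP[Cn nC] aB mb mb2.
have Ci0 : 0 < C^-1 by rewrite invr_gt0.
have m0 : 0 < m by exact: lt_le_trans Cm.
have n0 : 0 < n by exact: lt_le_trans Cn.
have e1_le : e1 <= e / 2.
  rewrite /e1 ler_pM2l// lef_pV2 ?posrE ?mulr_gt0 ?exprn_gt0//.
  by rewrite expr2; nra.
have large (k l x y : R) : 0 < k -> k <= C -> C^-1 <= l ->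
    `|k * y - l * x| <= d -> e / 2 <= `|x| -> e1 <= `|y|.
  move=> k0 kC Cl klxy ex.
  have l0 : 0 < l by exact: lt_le_trans Cl.
  have : l * `|x| <= k * `|y| + d.
    rewrite -[l in leLHS]gtr0_norm// -[k in leRHS]gtr0_norm// -!normrM.
    rewrite -lerBlDl (le_trans _ klxy)// distrC.
    exact: lerB_dist.
  have : C^-1 * (e / 2) <= l * `|x| by rewrite ler_pM// ltW// divr_gt0.
  have : k * `|y| <= C * `|y| by rewrite ler_wpM2r.
  have -> : e1 = (e / (4 * C)) / C by rewrite /e1; field; rewrite gt_eqF.
  have -> : C^-1 * (e / 2) = 2 * (e / (4 * C)) by field; rewrite gt_eqF.
  rewrite ler_pdivrMr// [leRHS]mulrC; lra.
have [ab|ab] := lerP `|a - b| e => //; exfalso.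
have ab1 : e1 <= `|a| /\ e1 <= `|b|.
  have [ea|ae] := lerP (e / 2) `|a|.
    split; first exact: le_trans ea.
    exact: (large m n a b).
  have [eb|be] := lerP (e / 2) `|b|.
    split; last exact: le_trans eb.
    by apply: (large n m b a) => //; rewrite distrC.
  by move: ab; have := ler_normB a b; lra.
have [a1 b1] := ab1.
have idE : m * n * (a * b * (b - a)) =
    (m * b ^+ 2 - n * a ^+ 2) * (n * a) - (m * b - n * a) * (n * a ^+ 2).
  by ring.
have upper : `|m * n * (a * b * (b - a))| <= d * (C * (B + B ^+ 2)).
  rewrite idE (le_trans (ler_normB _ _))// mulrDr mulrDr !(normrX, normrM).
  rewrite (gtr0_norm n0).
  apply: lerD; apply: ler_pM => //; rewrite ?mulr_ge0// ?(ltW n0)//;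
    apply: ler_pM => //; rewrite ?(ltW n0)// ?exprn_ge0//.
  by rewrite lerXn2r// nnegrE.
have lower : C ^- 2 * (e1 ^+ 2 * e) < `|m * n * (a * b * (b - a))|.
  rewrite !normrM (gtr0_norm m0) (gtr0_norm n0) -exprVn !expr2.
  apply: (@le_lt_trans _ _ (m * n * (e1 * e1 * e))).
    apply: ler_wpM2r; first by apply: ltW; do 2 apply: mulr_gt0 => //.
    by apply: ler_pM => //; exact: ltW.
  rewrite ltr_pM2l; last exact: mulr_gt0.
  apply: (@le_lt_trans _ _ (`|a| * `|b| * e)).
    apply: ler_wpM2r; first exact: ltW.
    by apply: ler_pM => //; exact: ltW.
  rewrite ltr_pM2l 1?distrC//.
  by apply: mulr_gt0; [exact: lt_le_trans a1|exact: lt_le_trans b1].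
have : d * (C * (B + B ^+ 2)) <= C ^- 2 * (e1 ^+ 2 * e).
  apply: (@le_trans _ _ (e * e1 ^+ 2 / D * (C * (B + B ^+ 2 + 1)))).
    apply: ler_pM => //; first exact: ltW.
      by rewrite mulr_ge0 ?addr_ge0 ?exprn_ge0// ltW.
    by rewrite ler_pM2l// lerDl.
  rewrite le_eqVlt; apply/orP; left; apply/eqP; rewrite /D; field.
  by rewrite (gt_eqF C_gt0)/= gt_eqF// ltr_wpDl// addr_ge0// exprn_ge0.
by lra.
Qed.

(** * Continuity on compact subgroups *)

Theorem lemma6p3 (R : realType) (Omega : topologicalType)
    (lcOmega : locally_compact [set: Omega])
    (hOmega : hausdorff_space Omega)
    (G : set (LatAut R Omega))
    (subgroupG : group_closed [in G])
    (compactG : compact G) :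
  {within G, continuous (@p_homeo R Omega)}.
Proof.
have GV T : G T -> G (T^-1)%g.
  have [G1 Gdiv] := subgroupG; move=> GT.
  have := Gdiv 1%g T G1; rewrite div1g => H; apply/set_mem/H; exact/mem_set.
have [|M GM] := @LatAut_pointwise_bounded _ _ G.
  move=> f; have : compact ((fun T : LatAut R Omega => T f) @` G).
    apply: continuous_compact => //; apply: continuous_subspaceT.
    exact: continuous_LatAut_eval.
  move=> /compact_bounded[M [_ /(_ (`|M| + 1))]].
  have -> : M < `|M| + 1 by rewrite (le_lt_trans (ler_norm M))// ltrDl.
  by move=> /(_ isT) H; exists (`|M| + 1) => T GT; apply: H; exists T.
pose C := `|M| + 1; have C1 : 1 <= C by rewrite lerDr.
have C_gt0 : 0 < C by rewrite (lt_le_trans _ C1).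
have MC : M <= C by rewrite (le_trans (ler_norm M))// lerDl.
have /choice[m mP] := p_homeoE R Omega lcOmega hOmega.
have mC T w : G T -> C^-1 <= m T w <= C.
  move=> GT; apply/andP; split; last first.
    rewrite (le_trans _ MC)//.
    apply: (@LatAut_weight_bounded _ _ lcOmega hOmega T
      (homeo_inv (p_homeo T)) (m T)) => f v; first exact: mP.
    exact: GM.
  (* Evaluating [u = T (T^-1 u)] at [w] writes [1] as [m T w] times a value of [T^-1 u], which is at
     most [C] because [T^-1] lies in [G]. *)
  have [u [uw u01]] := C0_one R _ lcOmega hOmega w.
  have := mP T (LatAut_inv T u) w; rewrite LatAut_invK uw => E.
  rewrite -[leRHS]mulr1 -[C^-1]mul1r ler_pdivrMr// mulr1 E.
  rewrite ler_wpM2l ?(ltW (Cb_pp_gt0 _ _))// (le_trans _ MC)//.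
  exact: (GM _ _ _ (GV _ GT)).
apply/subspace_continuousP => T GT; apply: homeo_continuous_at => f e e0.
(* [d] depends only on [C], the norm of [f] and [e], so one neighbourhood of [T] serves all points
   [w]. *)
have [d d0 dP] := @weights_close R C `|f| e C1 (normr_ge0 _) e0.
have near_d (g : C0 R Omega) : nbhs T [set S : LatAut R Omega |
    forall w, `|S g w - T g w| <= d].
  have /cvgrPdist_le/(_ d d0) := continuous_LatAut_eval _ _ g T.
  apply: filterS => S Sd w; apply: le_trans Sd; rewrite distrC.
  exact: (le_C0_norm (T g - S g)).
apply: filterS2 (near_d f) (near_d (MkC0 (C0_sqr _ _ f))) => S Sf Sf2 GS w.
(* Here [a] and [b] are the values of [p(T) f] and [p(S) f] at [w]; the weighted differences are
   [S g w - T g w] for [g = f] and [g = f^2]. *)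
apply: (dP (m S w) (m T w)); [exact: mC|exact: mC| | |].
- exact: (le_C0_norm f (homeo_inv (p_homeo T) w)).
- by rewrite -!mP.
- by have := Sf2 w; rewrite !mP.
Qed.
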